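(* Let $\mathcal{A}\subseteq\{\mathsf{C},\mathsf{N},\mathsf{P},\mathsf{D},\mathsf{T},\mathsf{4}\}$. Then the linear nested sequent calculus $\mathsf{LNS}_{\mathsf{M}\mathcal{A}}$ extended with contraction and weakening is sound and complete for the logic $\mathsf{M}\mathcal{A}$: for every formula $A$, $A\in\mathsf{M}\mathcal{A}$ if and only if $\;\Rightarrow A$ is derivable in this calculus.
   Context: Formulas: propositional variables, $\bot,\top,\neg,\land,\lor,\to,\Box$. $\mathsf{M}\mathcal{A}$ is the smallest set of formulas containing all propositional tautologies, the axiom $\mathsf{M}: \Box(A\land B)\to(\Box A\land\Box B)$ and the axioms in $\mathcal{A}$, closed under modus ponens and the rule: from $A\to B$ and $B\to A$ infer $\Box A\to\Box B$; the axioms are $\mathsf{C}: (\Box A\land\Box B)\to\Box(A\land B)$, $\mathsf{N}: \Box\top$, $\mathsf{P}: \neg\Box\bot$, $\mathsf{D}: \neg(\Box A\land\Box\neg A)$, $\mathsf{T}: \Box A\to A$, $\mathsf{4}: \Box A\to\Box\Box A$. Structures: $\mathcal{X}::=\Gamma\Rightarrow\Delta\mid\Gamma\Rightarrow\Delta\,/_{\mathsf m}\,\Sigma\Rightarrow\Pi\mid\Gamma\Rightarrow\Delta\,/\,\mathcal{X}$ (finite multisets of formulas; the nesting $/_{\mathsf m}$ only at the end). $\mathcal{S}\{\Gamma\Rightarrow\Delta\}$ has a distinguished component; in rules below the displayed components are the last ones and $\mathcal{G}$ is a (possibly empty) prefix. $\mathsf{LNS}_{\mathsf{M}\mathcal{A}}$: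 propositional rules (zero-premiss $\mathcal{S}\{\Gamma,p\Rightarrow p,\Delta\}$ with $p$ atomic, $\mathcal{S}\{\Gamma,\bot\Rightarrow\Delta\}$, $\mathcal{S}\{\Gamma\Rightarrow\top,\Delta\}$, and the standard two-sided invertible rules for $\neg,\land,\lor,\to$ on one component), not applicable to the component after $/_{\mathsf m}$; $\Box^{\mathsf m}_R$: from $\mathcal{G}/\Gamma\Rightarrow\Delta/_{\mathsf m}\Rightarrow B$ infer $\mathcal{G}/\Gamma\Rightarrow\Box B,\Delta$; $\Box^{\mathsf m}_L$: from $\mathcal{G}/\Gamma\Rightarrow\Delta/\Sigma,A\Rightarrow\Pi$ infer $\mathcal{G}/\Gamma,\Box A\Rightarrow\Delta/_{\mathsf m}\Sigma\Rightarrow\Pi$; and for each element of $\mathcal{A}$ the rule: $\mathsf{C}$: from $\mathcal{G}/_{\mathsf m}\Gamma\Rightarrow\Delta$ infer $\mathcal{G}/\Gamma\Rightarrow\Delta$; $\mathsf{N}$: from $\mathcal{G}/\Gamma\Rightarrow\Delta$ infer $\mathcal{G}/_{\mathsf m}\Gamma\Rightarrow\Delta$; $\mathsf{P}$: from $\mathcal{G}/\Gamma\Rightarrow\Delta/_{\mathsf m}\Rightarrow\;$ infer $\mathcal{G}/\Gamma\Rightarrow\Delta$; $\mathsf{D}$: from $\mathcal{G}/\Gamma\Rightarrow\Delta/_{\mathsf m}A\Rightarrow\;$ infer $\mathcal{G}/\Gamma,\Box A\Rightarrow\Delta$; $\mathsf{T}$: from $\mathcal{G}/\Gamma\Rightarrow\Delta/_{\mathsf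 m}\Sigma\Rightarrow\Pi$ infer $\mathcal{G}/\Gamma,\Sigma\Rightarrow\Delta,\Pi$; $\mathsf{4}$: from $\mathcal{G}/\Gamma\Rightarrow\Delta/\Sigma,\Box A\Rightarrow\Pi$ infer $\mathcal{G}/\Gamma,\Box A\Rightarrow\Delta/_{\mathsf m}\Sigma\Rightarrow\Pi$. Contraction and weakening: usual left/right rules inside a component. *)

(* Defs.v *)
From Stdlib Require List.
From HB Require Import structures.
From mathcomp Require Import all_boot.
From mathcomp Require Import finmap multiset.

Set Implicit Arguments.
Unset Strict Implicit.
Unset Printing Implicit Defensive.

Local Open Scope mset_scope.

Inductive form : Type :=
  | Var of nat
  | Bot
  | Top
  | Neg of form
  | And of form & form
  | Or of form & form
  | Imp of form & form
  | Box of form.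

(* Encoding into generic trees, used only to obtain the choiceType structure
   on [form] that multisets of formulas require. *)
Fixpoint tree_of_form (A : form) : GenTree.tree nat :=
  match A with
  | Var p => GenTree.Leaf p
  | Bot => GenTree.Node 0 [::]
  | Top => GenTree.Node 1 [::]
  | Neg A => GenTree.Node 2 [:: tree_of_form A]
  | And A B => GenTree.Node 3 [:: tree_of_form A; tree_of_form B]
  | Or A B => GenTree.Node 4 [:: tree_of_form A; tree_of_form B]
  | Imp A B => GenTree.Node 5 [:: tree_of_form A; tree_of_form B]
  | Box A => GenTree.Node 6 [:: tree_of_form A]
  end.

Fixpoint form_of_tree (t : GenTree.tree nat) : option form :=
  match t with
  | GenTree.Leaf p => Some (Var p)
  | GenTree.Node 0 [::] => Some Bot
  | GenTree.Node 1 [::] => Some Top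
  | GenTree.Node 2 [:: t] => omap Neg (form_of_tree t)
  | GenTree.Node 3 [:: t; u] =>
      obind (fun A => omap (And A) (form_of_tree u)) (form_of_tree t)
  | GenTree.Node 4 [:: t; u] =>
      obind (fun A => omap (Or A) (form_of_tree u)) (form_of_tree t)
  | GenTree.Node 5 [:: t; u] =>
      obind (fun A => omap (Imp A) (form_of_tree u)) (form_of_tree t)
  | GenTree.Node 6 [:: t] => omap Box (form_of_tree t)
  | _ => None
  end.

Lemma tree_of_formK : pcancel tree_of_form form_of_tree.
Proof.
by elim=> //= [A -> | A -> B -> | A -> B -> | A -> B -> | A ->].
Qed.

HB.instance Definition _ := Countable.copy form (pcan_type tree_of_formK).

Inductive modal_axiom : Type := AxC | AxN | AxP | AxD | AxT | Ax4.

Definition ord_of_axiom (a : modal_axiom) : 'I_6 :=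
  match a with
  | AxC => inord 0 | AxN => inord 1 | AxP => inord 2
  | AxD => inord 3 | AxT => inord 4 | Ax4 => inord 5
  end.

Definition axiom_of_ord (i : 'I_6) : modal_axiom :=
  nth AxC [:: AxC; AxN; AxP; AxD; AxT; Ax4] i.

Lemma ord_of_axiomK : cancel ord_of_axiom axiom_of_ord.
Proof. by case; rewrite /axiom_of_ord /= inordK. Qed.

HB.instance Definition _ := Finite.copy modal_axiom (can_type ord_of_axiomK).

Inductive axiom_instance : modal_axiom -> form -> Prop :=
  | InstC A B :
      axiom_instance AxC (Imp (And (Box A) (Box B)) (Box (And A B)))
  | InstN : axiom_instance AxN (Box Top)
  | InstP : axiom_instance AxP (Neg (Box Bot))
  | InstD A : axiom_instance AxD (Neg (And (Box A) (Box (Neg A))))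
  | InstT A : axiom_instance AxT (Imp (Box A) A)
  | Inst4 A : axiom_instance Ax4 (Imp (Box A) (Box (Box A))).

(* Truth under a Boolean assignment to the propositional variables and to the
   boxed formulas, the latter being treated as further atoms. *)
Fixpoint truth (v : nat -> bool) (b : form -> bool) (A : form) : bool :=
  match A with
  | Var p => v p
  | Bot => false
  | Top => true
  | Neg A => ~~ truth v b A
  | And A B => truth v b A && truth v b B
  | Or A B => truth v b A || truth v b B
  | Imp A B => truth v b A ==> truth v b B
  | Box A => b A
  end.

Definition tautology (A : form) : Prop := forall v b, truth v b A.

Inductive logicM (Ax : {set modal_axiom}) : form -> Prop :=
  | LTaut A : tautology A -> logicM Ax A
  | LM A B : logicM Ax (Imp (Box (And A B)) (And (Box A) (Box B)))
  | LAx a A : a \in Ax -> axiom_instance a A -> logicM Ax A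
  | LMP A B : logicM Ax A -> logicM Ax (Imp A B) -> logicM Ax B
  | LRE A B : logicM Ax (Imp A B) -> logicM Ax (Imp B A) ->
      logicM Ax (Imp (Box A) (Box B)).

Definition sequent : Type := ({mset form} * {mset form})%type.

Notation "G ⇒ D" := (@pair {mset form} {mset form} G D)
  (at level 65, no associativity).

Inductive lns : Type :=
  | Comp of sequent                (* s *)
  | CompM of sequent & sequent     (* s /ₘ t *)
  | Nest of sequent & lns.         (* s / X *)

Notation "s /ₘ t" := (CompM s t) (at level 68, no associativity).

(* [G ⫽ X] is the structure X preceded by the (possibly empty) prefix G. As
   /ₘ can only be the last nesting, a prefix is a list of sequents. A prefix
   that has to be followed directly by /ₘ is nonempty, and is written with its
   last component displayed: [G ⫽ s /ₘ t]. *)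
Definition after (G : seq sequent) (X : lns) : lns := foldr Nest X G.

Notation "G ⫽ X" := (after G X) (at level 69, right associativity).

(* Structures C{ } with one distinguished component. *)
Inductive context : Type :=
  | Hole                           (* { } *)
  | HoleM of sequent               (* { } /ₘ t *)
  | MHole of sequent               (* s /ₘ { } *)
  | HoleNest of lns                (* { } / X *)
  | NestCtx of sequent & context.  (* s / C{ } *)

Fixpoint fill (C : context) (s : sequent) : lns :=
  match C with
  | Hole => Comp s
  | HoleM t => s /ₘ t
  | MHole r => r /ₘ s
  | HoleNest X => Nest s X
  | NestCtx r C => Nest r (fill C s)
  end.

Fixpoint hole_after_m (C : context) : bool :=
  match C with
  | MHole _ => true
  | NestCtx _ C => hole_after_m C
  | _ => false
  end.

(* A rule relates the list of its premisses to its conclusion. *)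
Inductive prop_step : seq sequent -> sequent -> Prop :=
  | Init p Γ Δ : prop_step [::] (Var p +` Γ ⇒ Var p +` Δ)
  | BotL Γ Δ : prop_step [::] (Bot +` Γ ⇒ Δ)
  | TopR Γ Δ : prop_step [::] (Γ ⇒ Top +` Δ)
  | NegL A Γ Δ : prop_step [:: Γ ⇒ A +` Δ] (Neg A +` Γ ⇒ Δ)
  | NegR A Γ Δ : prop_step [:: A +` Γ ⇒ Δ] (Γ ⇒ Neg A +` Δ)
  | AndL A B Γ Δ : prop_step [:: A +` (B +` Γ) ⇒ Δ] (And A B +` Γ ⇒ Δ)
  | AndR A B Γ Δ :
      prop_step [:: Γ ⇒ A +` Δ; Γ ⇒ B +` Δ] (Γ ⇒ And A B +` Δ)
  | OrL A B Γ Δ :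
      prop_step [:: A +` Γ ⇒ Δ; B +` Γ ⇒ Δ] (Or A B +` Γ ⇒ Δ)
  | OrR A B Γ Δ : prop_step [:: Γ ⇒ A +` (B +` Δ)] (Γ ⇒ Or A B +` Δ)
  | ImpL A B Γ Δ :
      prop_step [:: Γ ⇒ A +` Δ; B +` Γ ⇒ Δ] (Imp A B +` Γ ⇒ Δ)
  | ImpR A B Γ Δ : prop_step [:: A +` Γ ⇒ B +` Δ] (Γ ⇒ Imp A B +` Δ).

Inductive struct_step : seq sequent -> sequent -> Prop :=
  | ConL A Γ Δ : struct_step [:: A +` (A +` Γ) ⇒ Δ] (A +` Γ ⇒ Δ)
  | ConR A Γ Δ : struct_step [:: Γ ⇒ A +` (A +` Δ)] (Γ ⇒ A +` Δ)
  | WeakL A Γ Δ : struct_step [:: Γ ⇒ Δ] (A +` Γ ⇒ Δ)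
  | WeakR A Γ Δ : struct_step [:: Γ ⇒ Δ] (Γ ⇒ A +` Δ).

Inductive modal_rule (Ax : {set modal_axiom}) : seq lns -> lns -> Prop :=
  | BoxR G Γ Δ B :
      modal_rule Ax [:: G ⫽ (Γ ⇒ Δ) /ₘ (mset0 ⇒ [mset B])]
                    (G ⫽ Comp (Γ ⇒ Box B +` Δ))
  | BoxL G Γ Δ Σ Π A :
      modal_rule Ax [:: G ⫽ Nest (Γ ⇒ Δ) (Comp (A +` Σ ⇒ Π))]
                    (G ⫽ (Box A +` Γ ⇒ Δ) /ₘ (Σ ⇒ Π))
  | RuleC G s Γ Δ : AxC \in Ax ->
      modal_rule Ax [:: G ⫽ s /ₘ (Γ ⇒ Δ)] (G ⫽ Nest s (Comp (Γ ⇒ Δ)))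
  | RuleN G s Γ Δ : AxN \in Ax ->
      modal_rule Ax [:: G ⫽ Nest s (Comp (Γ ⇒ Δ))] (G ⫽ s /ₘ (Γ ⇒ Δ))
  | RuleP G Γ Δ : AxP \in Ax ->
      modal_rule Ax [:: G ⫽ (Γ ⇒ Δ) /ₘ (mset0 ⇒ mset0)] (G ⫽ Comp (Γ ⇒ Δ))
  | RuleD G Γ Δ A : AxD \in Ax ->
      modal_rule Ax [:: G ⫽ (Γ ⇒ Δ) /ₘ ([mset A] ⇒ mset0)]
                    (G ⫽ Comp (Box A +` Γ ⇒ Δ))
  | RuleT G Γ Δ Σ Π : AxT \in Ax ->
      modal_rule Ax [:: G ⫽ (Γ ⇒ Δ) /ₘ (Σ ⇒ Π)]
                    (G ⫽ Comp (Γ `+` Σ ⇒ Δ `+` Π))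
  | Rule4 G Γ Δ Σ Π A : Ax4 \in Ax ->
      modal_rule Ax [:: G ⫽ Nest (Γ ⇒ Δ) (Comp (Box A +` Σ ⇒ Π))]
                    (G ⫽ (Box A +` Γ ⇒ Δ) /ₘ (Σ ⇒ Π)).

Inductive LNS_M (Ax : {set modal_axiom}) : seq lns -> lns -> Prop :=
  | LNSProp C ps c : ~~ hole_after_m C -> prop_step ps c ->
      LNS_M Ax (map (fill C) ps) (fill C c)
  | LNSModal ps c : modal_rule Ax ps c -> LNS_M Ax ps c.

(* Unlike the propositional rules, contraction and weakening may act on any
   component, including the one after /ₘ. *)
Inductive LNS_M_ConW (Ax : {set modal_axiom}) : seq lns -> lns -> Prop :=
  | ConWBase ps c : LNS_M Ax ps c -> LNS_M_ConW Ax ps c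
  | ConWStruct C ps c : struct_step ps c ->
      LNS_M_ConW Ax (map (fill C) ps) (fill C c).

Inductive derivable (R : seq lns -> lns -> Prop) : lns -> Prop :=
  | Derive ps c : R ps c -> (forall p, List.In p ps -> derivable R p) ->
      derivable R c.

(* Main.v *)
(** Soundness.  A structure is interpreted by the provability of formulas of the
    Hilbert system, [s /ₘ t] by that of [s \/ Box t]; once a component is
    followed by two others it interacts with nothing any more, so a longer
    structure only has to have one provable component or a valid end.

    Completeness.  No cut is needed: maximal underivable pairs of sets of
    formulas are the worlds of a monotone neighbourhood model in which formulas
    on the left hold and formulas on the right fail.  The neighbourhoods of a
    world are generated by the formulas that the rules [BoxL], [4], [C] and [N]
    can move out of its boxes, and each modal rule yields the frame condition
    of its axiom, so every theorem of the logic holds in all worlds. *)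

From Stdlib Require List.
Require Import Defs.
From mathcomp Require Import all_boot.
From mathcomp Require Import finmap multiset.
From mathcomp.classical Require Import boolp.

Set Implicit Arguments.
Unset Strict Implicit.
Unset Printing Implicit Defensive.

Local Open Scope mset_scope.

(** * Quantifiers over sums and singletons of multisets *)

Section MultisetQuantifiers.

Context (K : choiceType) (P : pred K).
Implicit Types A B : {mset K}.

Lemma all_msetD A B : all P (A `+` B) = all P A && all P B.
Proof.
rewrite -all_cat; apply: eq_all_r => x.
by rewrite in_msetD mem_cat.
Qed.

Lemma has_msetD A B : has P (A `+` B) = has P A || has P B.
Proof.
rewrite -has_cat; apply: eq_has_r => x.
by rewrite in_msetD mem_cat.
Qed.

Lemma all_mset1 x : all P [mset x] = P x.
Proof. by rewrite enum_msetn /= andbT. Qed.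

Lemma has_mset1 x : has P [mset x] = P x.
Proof. by rewrite enum_msetn /= orbF. Qed.

End MultisetQuantifiers.

Definition quant_msetE :=
  (all_msetD, has_msetD, all_mset1, has_mset1, @enum_mset0 form).

(** * Soundness *)

Definition entails (A B : form) : Prop :=
  forall v b, truth v b A -> truth v b B.

Lemma logicM_entails Ax A B : logicM Ax A -> entails A B -> logicM Ax B.
Proof.
by move=> pA AB; apply: LMP pA (LTaut _ _) => v b /=; apply/implyP/AB.
Qed.

Lemma logicM_and Ax A B : logicM Ax A -> logicM Ax B -> logicM Ax (And A B).
Proof.
move=> pA pB; apply: LMP pB (logicM_entails pA _) => v b /= ->.
by rewrite implybb.
Qed.

Lemma logicM_entails2 Ax A B C : logicM Ax A -> logicM Ax B ->
  entails (And A B) C -> logicM Ax C.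
Proof. by move=> pA pB; apply/logicM_entails/logicM_and. Qed.

(** When [Imp A B] is provable, [A] is equivalent to [And A B]; the congruence rule boxes this
    equivalence and M then splits off [Box B]. *)
Lemma logicM_box_mono Ax A B :
  logicM Ax (Imp A B) -> logicM Ax (Imp (Box A) (Box B)).
Proof.
move=> AB; have bAAB: logicM Ax (Imp (Box A) (Box (And A B))).
  by apply: LRE; apply: (logicM_entails AB) => v b /=;
    case: (truth v b A) (truth v b B) => -[].
apply: (logicM_entails2 bAAB (LM Ax A B)) => v b /=.
by case: (b A) (b B) (b (And A B)) => -[] [].
Qed.

Lemma entails_box Ax A B : entails A B -> logicM Ax (Imp (Box A) (Box B)).
Proof.
by move=> AB; apply/logicM_box_mono/LTaut => v b /=; apply/implyP/AB.
Qed.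

Definition seq_form (s : sequent) : form :=
  Imp (foldr And Top s.1) (foldr Or Bot s.2).

Lemma truth_seq_form v b s :
  truth v b (seq_form s) = all (truth v b) s.1 ==> has (truth v b) s.2.
Proof.
by congr (_ ==> _); [elim: (EnumMset.f s.1) | elim: (EnumMset.f s.2)] => //= A l ->.
Qed.

#[local] Opaque seq_form.

(* Without C, the last component of [s / t] cannot be reasoned about under the
   box of [s], because branching rules act on it; validity is then that of one
   of the two components.  With C, [s \/ Box t] survives branching. *)
Fixpoint valid Ax (X : lns) : Prop :=
  match X with
  | Comp s => logicM Ax (seq_form s)
  | s /ₘ t => logicM Ax (Or (seq_form s) (Box (seq_form t)))
  | Nest s Y =>
      [\/ logicM Ax (seq_form s), valid Ax Y
        | AxC \in Ax /\ exists2 t, Y = Comp t &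
            logicM Ax (Or (seq_form s) (Box (seq_form t)))]
  end.

Definition seqs_form (ps : seq sequent) : form :=
  foldr And Top (map seq_form ps).

Lemma truth_seqs_form v b ps :
  truth v b (seqs_form ps) = all (fun p => truth v b (seq_form p)) ps.
Proof. by elim: ps => //= p ps ->. Qed.

Ltac truth_cases v b :=
  repeat match goal with
  | |- context [all (truth v b) ?s] => case: (all (truth v b) s)
  | |- context [has (truth v b) ?s] => case: (has (truth v b) s)
  | |- context [truth v b ?A] => case: (truth v b A)
  | |- context [v ?p] => case: (v p)
  | |- context [b ?A] => case: (b A)
  end.

Lemma prop_step_entails ps c :
  prop_step ps c -> entails (seqs_form ps) (seq_form c).
Proof.
move=> st v b; apply/implyP; rewrite truth_seqs_form truth_seq_form.
by case: st => *; cbn [all fst snd];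
  rewrite ?truth_seq_form; cbn [fst snd]; rewrite ?quant_msetE; cbn [truth];
  truth_cases v b.
Qed.

Lemma struct_step_entails ps c :
  struct_step ps c -> entails (seqs_form ps) (seq_form c).
Proof.
move=> st v b; apply/implyP; rewrite truth_seqs_form truth_seq_form.
by case: st => *; cbn [all fst snd];
  rewrite ?truth_seq_form; cbn [fst snd]; rewrite ?quant_msetE; cbn [truth];
  truth_cases v b.
Qed.

Lemma logicM_seqs_form Ax F ps :
  (forall p, List.In p ps -> logicM Ax (Or F (seq_form p))) ->
  logicM Ax (Or F (seqs_form ps)).
Proof.
elim: ps => [|p ps IH] pr; first by apply: LTaut => v b /=; rewrite orbT.
have hp := pr p (or_introl erefl).
have hps := IH (fun q hq => pr q (or_intror hq)).
by apply: (logicM_entails2 hp hps) => v b /=; rewrite orb_andr.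
Qed.

(** [F] holds what the rest of the structure contributes: [Bot] for nothing, or the box of the next
    component. *)
Lemma logicM_step Ax F ps c : entails (seqs_form ps) (seq_form c) ->
  (forall p, List.In p ps -> logicM Ax (Or F (seq_form p))) ->
  logicM Ax (Or F (seq_form c)).
Proof.
move=> st /logicM_seqs_form/logicM_entails; apply => v b /=.
by case: (truth v b F) => //=; apply: st.
Qed.

Lemma logicM_OrBot Ax A : logicM Ax (Or Bot A) <-> logicM Ax A.
Proof. by split=> /logicM_entails; apply. Qed.

Lemma logicM_OrC Ax A B : logicM Ax (Or A B) -> logicM Ax (Or B A).
Proof. by move=> /logicM_entails; apply => v b /=; rewrite orbC. Qed.

Lemma logicM_Orl Ax A B : logicM Ax A -> logicM Ax (Or A B).
Proof. by move=> /logicM_entails; apply => v b /= ->. Qed.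

Lemma logicM_Orr Ax A B : logicM Ax B -> logicM Ax (Or A B).
Proof. by move=> /logicM_Orl/logicM_OrC. Qed.

Lemma logicM_Or_box Ax F A B : entails A B ->
  logicM Ax (Or F (Box A)) -> logicM Ax (Or F (Box B)).
Proof.
move=> /(entails_box Ax) AB FA; apply: (logicM_entails2 AB FA) => v b /=.
by case: (truth v b F) (b A) (b B) => -[] [].
Qed.

(** Provable formulas go under the box by monotonicity and two boxes merge by C, so the premisses of
    a branching rule may mix the two ways of being valid. *)
Lemma seqs_form_nested (Ax : {set modal_axiom}) F ps : AxC \in Ax ->
  (forall p, List.In p ps -> logicM Ax (seq_form p) \/
     logicM Ax (Or F (Box (seq_form p)))) ->
  logicM Ax (seqs_form ps) \/ logicM Ax (Or F (Box (seqs_form ps))).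
Proof.
move=> inC; elim: ps => [|p ps IH] pr; first by left; apply: LTaut.
have {}IH := IH (fun q hq => pr q (or_intror hq)).
have key A B : logicM Ax A -> logicM Ax (Or F (Box B)) ->
    logicM Ax (Or F (Box (And A B))).
  move=> pA; have BAB: logicM Ax (Imp (Box B) (Box (And A B))).
    by apply/logicM_box_mono/(logicM_entails pA) => v b /= ->; apply: implybb.
  move=> /(logicM_entails2 BAB); apply => v b /=.
  by case: (truth v b F) (b B) (b (And A B)) => -[] [].
case: (pr p (or_introl erefl)) IH => hp [hps|hps].
- by left; apply: logicM_and.
- by right; apply: key.
- right; apply: logicM_Or_box (key _ _ hps hp) => v b /=.
  by rewrite andbC.
right; have Cax := LAx inC (InstC (seq_form p) (seqs_form ps)).
apply: (logicM_entails2 (logicM_and hp hps) Cax) => v b /=.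
by case: (truth v b F) (b _) (b _) (b _) => -[] [] [].
Qed.

(** Behind [/ₘ] the box need not commute with conjunction, hence the restriction to one premiss
    there; contraction and weakening satisfy it. *)
Lemma valid_fill_step Ax C ps c : entails (seqs_form ps) (seq_form c) ->
  size ps = 1 \/ ~~ hole_after_m C ->
  (forall p, List.In p ps -> valid Ax (fill C p)) -> valid Ax (fill C c).
Proof.
move=> st; have stF F := @logicM_step Ax F ps c st.
have st0 : (forall p, List.In p ps -> logicM Ax (seq_form p)) ->
    logicM Ax (seq_form c).
  by move=> h; apply/logicM_OrBot/stF => p /h /logicM_OrBot.
elim: C => [|t|r|X|r C IH] /= side pr.
- exact: st0.
- by apply/logicM_OrC/stF => p /pr /logicM_OrC.
- case: side => // /eqP; case: ps st pr {stF st0} => [|p [|//]] // st pr _.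
  apply: logicM_Or_box (pr p (or_introl erefl)) => v b tp.
  by apply: st; rewrite truth_seqs_form /= tp.
- have [vX|nX] := pselect (valid Ax X); first by constructor 2.
  (* As [X] is not valid, each premiss satisfies the first or the third disjunct, and both give the
     formula of the third. *)
  have [[inC [t eX]]|nC] := pselect (AxC \in Ax /\ exists t, X = Comp t).
    constructor 3; split=> //; exists t => //.
    apply/logicM_OrC/stF => p /pr [ps1|//|[_ [t' eX' ]]].
      exact: logicM_Orr.
    by move: eX'; rewrite eX => -[->] /logicM_OrC.
  constructor 1; apply: st0 => p /pr [//|//|[inC [t eX _]]].
  by case: nC; split=> //; exists t.
have [vr|nr] := pselect (logicM Ax (seq_form r)); first by constructor 1.
have [inC|nC] := boolP (AxC \in Ax); last first.
  by constructor 2; apply: (IH side) => p /pr [//|//|[]]; rewrite (negPf nC).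
(* Only with [Hole] is what follows [r] a single component, as the third disjunct requires. *)
case: C IH side pr => [|t|q|X|q C] IH side pr;
  try by constructor 2; apply: (IH side) => p /pr [//|//|[_ []]].
have /(seqs_form_nested inC) : forall p, List.In p ps ->
    logicM Ax (seq_form p) \/ logicM Ax (Or (seq_form r) (Box (seq_form p))).
  by move=> p /pr [//| |[_ [t [<-]]]]; [left | right].
case=> [vps|vps]; first by constructor 2; apply: logicM_entails vps st.
by constructor 3; split=> //; exists c => //; apply: logicM_Or_box vps.
Qed.

Lemma valid_after Ax G X :
  (exists2 r, List.In r G & logicM Ax (seq_form r)) \/ valid Ax X ->
  valid Ax (G ⫽ X).
Proof.
elim: G => [[[]|]//|r G IH] /= [[q [<-|hq] pq]|vX].
- by constructor 1.
- by constructor 2; apply: IH; left; exists q.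
by constructor 2; apply: IH; right.
Qed.

(** A single component has to be excluded: the last element of [G] may be linked to it by the C
    disjunct of [valid]. *)
Lemma valid_afterP Ax G X : (forall t, X <> Comp t) -> valid Ax (G ⫽ X) ->
  (exists2 r, List.In r G & logicM Ax (seq_form r)) \/ valid Ax X.
Proof.
move=> nX; elim: G => [|r G IH] /=; first by right.
case=> [pr|/IH [[q hq pq]|vX]|[_ [t eX _]]].
- by left; exists r => //; left.
- by left; exists q => //; right.
- by right.
by case: G eX {IH} => [/nX|].
Qed.

Lemma seq_form_addl A Γ Δ : entails (seq_form (A +` Γ ⇒ Δ))
  (Imp A (seq_form (Γ ⇒ Δ))).
Proof.
move=> v b; cbn [truth]; rewrite !truth_seq_form /= !quant_msetE.
by truth_cases v b.
Qed.

(* Common to the rules Box_L and 4, where [A] is the formula moved into the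
   last component and [D] the boxed formula it comes from. *)
Lemma valid_unbox Ax s t D A F :
  logicM Ax (Imp D (Box A)) -> entails (seq_form t) (Imp A F) ->
  valid Ax (Nest s (Comp t)) ->
  logicM Ax (Or (seq_form s) (Imp D (Box F))).
Proof.
move=> DA tAF [ps|pt|[inC [_ [<-] pst]]].
- exact: logicM_Orl.
- have AF := logicM_box_mono (logicM_entails pt tAF).
  apply: (logicM_entails2 DA AF) => v b /=.
  by case: (truth v b D) (b A) (b F) => -[] []; rewrite ?orbT.
(* C merges [Box A] with the box of [t], and [A] together with [t] entails [F]. *)
have Cax := LAx inC (InstC A (seq_form t)).
have AtF: logicM Ax (Imp (Box (And A (seq_form t))) (Box F)).
  by apply: entails_box => v b /andP[tA /tAF/implyP]; apply.
apply: (logicM_entails2 (logicM_and DA pst) (logicM_and Cax AtF)) => v b.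
by cbn [truth]; truth_cases v b.
Qed.

Lemma modal_rule_valid Ax ps c : modal_rule Ax ps c ->
  (forall p, List.In p ps -> valid Ax p) -> valid Ax c.
Proof.
(* Every premiss of a modal rule ends in two components, so [valid_afterP] reduces the rule to its
   active part. *)
have lift G X Y : (forall t, X <> Comp t) -> (valid Ax X -> valid Ax Y) ->
    (forall p, List.In p [:: G ⫽ X] -> valid Ax p) -> valid Ax (G ⫽ Y).
  move=> nX XY /(_ _ (or_introl erefl)) /(valid_afterP nX) [pr|/XY vY].
    by apply: valid_after; left.
  by apply: valid_after; right.
case=> [G Γ Δ B|G Γ Δ Σ Π A|G s Γ Δ inC|G s Γ Δ inN|G Γ Δ inP|G Γ Δ A inD
  |G Γ Δ Σ Π inT|G Γ Δ Σ Π A in4]; apply: lift => // v.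
- have v' : logicM Ax (Or (seq_form (Γ ⇒ Δ)) (Box B)).
    apply: logicM_Or_box v => v b.
    by rewrite truth_seq_form /= !quant_msetE.
  apply: (logicM_entails v') => w b; cbn [truth].
  rewrite !truth_seq_form /= !quant_msetE /=.
  by truth_cases w b.
- have bAA : logicM Ax (Imp (Box A) (Box A)) by apply: entails_box.
  have v' := valid_unbox bAA (@seq_form_addl _ _ _) v.
  apply: (logicM_entails v') => w b; cbn [truth].
  rewrite !truth_seq_form /= !quant_msetE /=.
  by truth_cases w b.
- by constructor 3; split=> //; exists (Γ ⇒ Δ).
- case: v => [vs|vt|[_ [t [<-]] //]]; first exact: logicM_Orl.
  (* N gives [Box Top], and [Top] implies the provable last component. *)
  apply: logicM_Orr; apply: LMP (LAx inN InstN) _.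
  by apply/logicM_box_mono/(logicM_entails vt) => w b /= ->.
- have v' : logicM Ax (Or (seq_form (Γ ⇒ Δ)) (Box Bot)).
    by apply: logicM_Or_box v => w b; rewrite truth_seq_form /= !quant_msetE.
  apply: (logicM_entails2 v' (LAx inP InstP)) => w b; cbn [truth].
  by case: (b Bot); rewrite ?andbF ?orbF ?andbT.
- have v' : logicM Ax (Or (seq_form (Γ ⇒ Δ)) (Box (Neg A))).
    apply: logicM_Or_box v => w b; rewrite truth_seq_form /= !quant_msetE.
    by case: (truth w b A).
  apply: (logicM_entails2 v' (LAx inD (InstD A))) => w b; cbn [truth].
  rewrite !truth_seq_form /= !quant_msetE /=.
  by truth_cases w b.
- have Tax := LAx inT (InstT (seq_form (Σ ⇒ Π))).
  apply: (logicM_entails2 v Tax) => w b; cbn [truth].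
  rewrite !truth_seq_form /= !quant_msetE /=.
  by truth_cases w b.
have v' := valid_unbox (LAx in4 (Inst4 A)) (@seq_form_addl _ _ _) v.
apply: (logicM_entails v') => w b; cbn [truth].
rewrite !truth_seq_form /= !quant_msetE /=.
by truth_cases w b.
Qed.

Lemma derivable_valid Ax X : derivable (LNS_M_ConW Ax) X -> valid Ax X.
Proof.
elim=> {}_ {}X [ps c [C {}ps {}c nC st|{}ps {}c st]|C ps c st] _ IH.
- apply: (valid_fill_step (prop_step_entails st)); first by right.
  by move=> p hp; apply: IH; apply: List.in_map.
- exact: modal_rule_valid IH.
apply: (valid_fill_step (struct_step_entails st)); first by left; case: st.
by move=> p hp; apply: IH; apply: List.in_map.
Qed.

Lemma soundness Ax A :
  derivable (LNS_M_ConW Ax) (Comp (mset0 ⇒ [mset A])) -> logicM Ax A.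
Proof.
move=> /derivable_valid /= /logicM_entails; apply=> v b.
by rewrite truth_seq_form /= !quant_msetE.
Qed.

Lemma seq_mset_nil (K : choiceType) : seq_mset [::] = mset0 :> {mset K}.
Proof. by apply/msetP => x; rewrite mset_seqE mset0E. Qed.

Lemma mem_seq_mset (K : choiceType) (l : seq K) : seq_mset l =i l.
Proof. exact/perm_mem/perm_eq_seq_mset. Qed.

(** * Derived rules *)

Lemma after_Comp G s : G ⫽ Comp s = fill (foldr NestCtx Hole G) s.
Proof. by elim: G => //= r G ->. Qed.

Lemma after_rcons G r X : rcons G r ⫽ X = G ⫽ Nest r X.
Proof. by rewrite /after foldr_rcons. Qed.

Lemma Hole_before_m G : ~~ hole_after_m (foldr NestCtx Hole G).
Proof. by elim: G. Qed.

Lemma derivable_modal Ax p c : modal_rule Ax [:: p] c ->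
  derivable (LNS_M_ConW Ax) p -> derivable (LNS_M_ConW Ax) c.
Proof.
by move=> st dp; apply: Derive (ConWBase (LNSModal st)) _ => q [<-|[]].
Qed.

(* Quantifying over the prefix makes the premiss of a modal rule, whose last
   component is one level deeper, an instance again. *)
Definition der Ax (s : sequent) : Prop :=
  forall G, derivable (LNS_M_ConW Ax) (G ⫽ Comp s).

Lemma der_prop Ax ps c : prop_step ps c ->
  (forall p, List.In p ps -> der Ax p) -> der Ax c.
Proof.
move=> st dps G; rewrite after_Comp.
apply: Derive (ConWBase (LNSProp Ax (Hole_before_m G) st)) _ => q.
by move=> /List.in_map_iff [p [<- /dps dp]]; rewrite -after_Comp.
Qed.

Lemma der_struct Ax p c : struct_step [:: p] c -> der Ax p -> der Ax c.
Proof.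
move=> st dp G; rewrite after_Comp.
apply: Derive (ConWStruct Ax _ st) _ => q [<-|[]].
by rewrite -after_Comp.
Qed.

Lemma der_weak Ax (Γ Δ Γ' Δ' : {mset form}) :
  der Ax (Γ ⇒ Δ) -> der Ax (Γ' `+` Γ ⇒ Δ' `+` Δ).
Proof.
rewrite -(seq_mset_id Γ') -(seq_mset_id Δ') => d.
elim: (EnumMset.f Γ') => [|A l IH].
  rewrite seq_mset_nil mset0D; elim: (EnumMset.f Δ') => [|A l IH].
    by rewrite seq_mset_nil mset0D.
  by rewrite mset_cons -msetDA; apply: der_struct (WeakR _ _ _) IH.
by rewrite mset_cons -msetDA; apply: der_struct (WeakL _ _ _) IH.
Qed.

Lemma der_contrL Ax (Σ Γ Δ : {mset form}) :
  {subset Σ <= Γ} -> der Ax (Σ `+` Γ ⇒ Δ) -> der Ax (Γ ⇒ Δ).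
Proof.
rewrite -(seq_mset_id Σ); move: (EnumMset.f Σ) => l.
elim: l => [|A l IH] sub; first by rewrite seq_mset_nil mset0D.
move: sub; rewrite mset_cons -msetDA => sub d; apply: IH.
  by move=> x xl; apply: sub; rewrite in_mset1D xl orbT.
have AG : A \in seq_mset l `+` Γ by rewrite in_msetD sub ?orbT // mset1D1.
by move: d; rewrite -(msetB1K AG); apply: der_struct (ConL _ _ _).
Qed.

Lemma der_contrR Ax (Π Γ Δ : {mset form}) :
  {subset Π <= Δ} -> der Ax (Γ ⇒ Π `+` Δ) -> der Ax (Γ ⇒ Δ).
Proof.
rewrite -(seq_mset_id Π); move: (EnumMset.f Π) => l.
elim: l => [|A l IH] sub; first by rewrite seq_mset_nil mset0D.
move: sub; rewrite mset_cons -msetDA => sub d; apply: IH.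
  by move=> x xl; apply: sub; rewrite in_mset1D xl orbT.
have AD : A \in seq_mset l `+` Δ by rewrite in_msetD sub ?orbT // mset1D1.
by move: d; rewrite -(msetB1K AD); apply: der_struct (ConR _ _ _).
Qed.

(** Weaken to the sum of both sequents, then contract. Multiplicities are irrelevant from here on:
    sequents act as pairs of finite sets. *)
Lemma der_sub Ax (Γ Δ Γ' Δ' : {mset form}) :
  {subset Γ <= Γ'} -> {subset Δ <= Δ'} ->
  der Ax (Γ ⇒ Δ) -> der Ax (Γ' ⇒ Δ').
Proof.
move=> sG sD /(@der_weak _ _ _ Γ' Δ') d.
apply/(der_contrR sD)/(der_contrL sG).
by rewrite (msetDC Γ) (msetDC Δ).
Qed.

Definition unbox (x : bool * form) : form := if x.1 then Box x.2 else x.2.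

(* The boxed formulas [Box x.2] that can be moved into the last component in
   one go, [x.1] telling whether the box is kept (rule 4) or not. *)
Definition unboxable (Ax : {set modal_axiom}) (l : seq (bool * form)) : Prop :=
  [/\ forall x, x \in l -> x.1 -> Ax4 \in Ax,
      l = [::] -> AxN \in Ax & 1 < size l -> AxC \in Ax].

(** Bottom-up, [BoxL] or [Rule4] moves one formula and turns [/ₘ] into an ordinary nesting, C
    restores [/ₘ] for the next formula, and N handles the empty list. *)
Lemma derivable_unbox Ax l G (Γ Δ Σ Π : {mset form}) : unboxable Ax l ->
  der Ax (seq_mset (map unbox l) `+` Σ ⇒ Π) ->
  derivable (LNS_M_ConW Ax)
    (G ⫽ (seq_mset [seq Box x.2 | x <- l] `+` Γ ⇒ Δ) /ₘ (Σ ⇒ Π)).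
Proof.
case: l => [|x l] [].
  move=> _ /(_ erefl) inN _ d.
  have d' : der Ax (Σ ⇒ Π) by move: d; rewrite seq_mset_nil mset0D.
  rewrite seq_mset_nil mset0D.
  by apply: derivable_modal (RuleN _ _ _ _ inN) _; rewrite -after_rcons.
move=> + _; elim: l x Σ => [|y l IH] [c A] Σ in4 inC d.
  have d' : der Ax (unbox (c, A) +` Σ ⇒ Π).
    apply: der_sub d => // B; rewrite !in_msetD.
    by rewrite mem_seq_mset /= inE in_mset1.
  rewrite mset_cons -msetDA.
  case: c {d inC} in4 d' => [/(_ _ (mem_head _ _) isT) in4|_] d'.
    by apply: derivable_modal (Rule4 _ _ _ _ _ _ in4) _;
      rewrite -after_rcons.
  by apply: derivable_modal (BoxL _ _ _ _ _ _ _) _; rewrite -after_rcons.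
have {}IH : derivable (LNS_M_ConW Ax) (G ⫽ (seq_mset [seq Box x.2 | x <- y :: l]
    `+` Γ ⇒ Δ) /ₘ (unbox (c, A) +` Σ ⇒ Π)).
  apply: IH => [x xl||]; first by apply: in4; rewrite inE xl orbT.
    by move=> _; apply: inC.
  by apply: der_sub d => // B; rewrite map_cons mset_cons msetDA
    [_ `+` [mset _]]msetDC.
have {}IH := derivable_modal (RuleC _ _ _ _ (inC isT)) IH.
rewrite map_cons mset_cons -msetDA.
case: c {inC d} in4 IH => [/(_ _ (mem_head _ _) isT) in4|_] IH.
  by apply: derivable_modal (Rule4 _ _ _ _ _ _ in4) _.
by apply: derivable_modal (BoxL _ _ _ _ _ _ _) _.
Qed.

Definition boxes (l : seq (bool * form)) : seq form := [seq Box x.2 | x <- l].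

Definition unboxes (l : seq (bool * form)) : seq form := map unbox l.

Lemma der_box Ax l B : unboxable Ax l ->
  der Ax (seq_mset (unboxes l) ⇒ [mset B]) ->
  der Ax (seq_mset (boxes l) ⇒ [mset Box B]).
Proof.
move=> lok d G; rewrite -[[mset Box B]]msetD0.
apply: derivable_modal (BoxR _ _ _ _ _) _.
by rewrite -[seq_mset _]msetD0; apply: derivable_unbox; rewrite ?msetD0.
Qed.

Lemma der_P (Ax : {set modal_axiom}) l : AxP \in Ax -> unboxable Ax l ->
  der Ax (seq_mset (unboxes l) ⇒ mset0) -> der Ax (seq_mset (boxes l) ⇒ mset0).
Proof.
move=> inP lok d G; apply: derivable_modal (RuleP _ _ _ inP) _.
by rewrite -[seq_mset _]msetD0; apply: derivable_unbox; rewrite ?msetD0.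
Qed.

Lemma der_D (Ax : {set modal_axiom}) l A : AxD \in Ax -> unboxable Ax l ->
  der Ax (A +` seq_mset (unboxes l) ⇒ mset0) ->
  der Ax (Box A +` seq_mset (boxes l) ⇒ mset0).
Proof.
move=> inD lok d G; apply: derivable_modal (RuleD _ _ _ _ inD) _.
by rewrite -[seq_mset _]msetD0; apply: derivable_unbox; rewrite // msetDC.
Qed.

(** T is applied with [Box A] alone in the first part and all of [Γ ⇒ Δ] in the second, to which
    [BoxL] then adds [A]. *)
Lemma der_T (Ax : {set modal_axiom}) A (Γ Δ : {mset form}) : AxT \in Ax ->
  der Ax (A +` Γ ⇒ Δ) -> der Ax (Box A +` Γ ⇒ Δ).
Proof.
move=> inT d G; rewrite -[Box A +` Γ]/(_ `+` _) -[Δ]mset0D.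
apply: derivable_modal (RuleT _ _ _ _ _ inT) _.
rewrite -[[mset Box A]]msetD0.
by apply: derivable_modal (BoxL _ _ _ _ _ _ _) _; rewrite -after_rcons.
Qed.

(** * The canonical neighbourhood model *)

(** One predicate for both sides of [⇒] lets a single enumeration treat them together. *)
Definition signed_set := bool * form -> Prop.

Definition covers (S : signed_set) (s : sequent) : Prop :=
  (forall A, A \in s.1 -> S (true, A)) /\ (forall A, A \in s.2 -> S (false, A)).

Definition consistent Ax (S : signed_set) : Prop :=
  forall s, covers S s -> ~ der Ax s.

Definition add_signed (x : bool * form) (s : sequent) : sequent :=
  if x.1 then x.2 +` s.1 ⇒ s.2 else s.1 ⇒ x.2 +` s.2.

(** Maximality is put in finitary form: a missing formula comes with a sequent of [w] that it makes
    derivable. *)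
Definition world Ax (w : signed_set) : Prop := consistent Ax w /\
  forall x, ~ w x -> exists2 s, covers w s & der Ax (add_signed x s).

Lemma covers_sub (S S' : signed_set) s :
  (forall x, S x -> S' x) -> covers S s -> covers S' s.
Proof. by move=> sub [cL cR]; split=> A hA; apply: sub; auto. Qed.

(** All copies of [x] are removed from [s]; by [der_sub], the single copy that [add_signed] puts
    back suffices. *)
Lemma covers_add (S : signed_set) x s :
  covers (fun y => S y \/ y = x) s ->
  exists2 s', covers S s' & forall Ax, der Ax s -> der Ax (add_signed x s').
Proof.
case: s => Γ Δ [/= cL cR].
pose r b (Σ : {mset form}) := seq_mset [seq A <- Σ | (b, A) != x].
have in_r b Σ A : (A \in r b Σ) = ((b, A) != x) && (A \in Σ).
  by rewrite mem_seq_mset mem_filter.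
exists (r true Γ ⇒ r false Δ).
  split=> A /=; rewrite in_r => /andP[/eqP Ax]; first by move=> /cL [].
  by move=> /cR [].
move=> Ax; rewrite /add_signed; case: x @r in_r {cL cR} => -[] B r in_r;
  apply: der_sub => A hA /=; rewrite ?in_mset1D in_r hA xpair_eqE ?andbT //=;
  by case: eqP.
Qed.

(** * Lindenbaum extension of consistent signed sets *)

Section Lindenbaum.

Context (Ax : {set modal_axiom}) (S : signed_set).

Fixpoint stage n : signed_set :=
  if n is m.+1 then fun y => stage m y \/
    choice.unpickle m = Some y /\ consistent Ax (fun z => stage m z \/ z = y)
  else S.

Definition limit : signed_set := fun y => exists n, stage n y.

Lemma stage_leq m n x : m <= n -> stage m x -> stage n x.
Proof.
move=> /subnK <- sm; elim: (n - m) => //= k IH.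
by left.
Qed.

Lemma consistent_sub (T T' : signed_set) :
  (forall x, T x -> T' x) -> consistent Ax T' -> consistent Ax T.
Proof. by move=> sub cT' s cs; apply/cT'/(covers_sub sub). Qed.

Lemma stage_consistent n : consistent Ax S -> consistent Ax (stage n).
Proof.
move=> cS; elim: n => //= n IH.
case: (pselect (exists y, choice.unpickle n = Some y /\
    consistent Ax (fun z => stage n z \/ z = y))) => [[y [ey cy]]|no].
  apply: consistent_sub cy => x [|[ex _]]; first by left.
  by right; move: ex; rewrite ey => -[].
by apply: consistent_sub IH => x [//|hx]; case: no; exists x.
Qed.

Lemma limit_stage (f : form -> bool * form) (l : seq form) :
  (forall A, A \in l -> limit (f A)) ->
  exists n, forall A, A \in l -> stage n (f A).
Proof.
elim: l => [|A l IH] lim; first by exists 0.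
have [B Bl|n hn] := IH; first by apply: lim; rewrite inE Bl orbT.
have [m hm] := lim A (mem_head _ _).
exists (maxn m n) => B; rewrite inE => /orP[/eqP->|/hn].
  by apply: stage_leq hm; apply: leq_maxl.
by apply: stage_leq; apply: leq_maxr.
Qed.

(** A sequent has finitely many formulas, so it is covered by some stage; a formula outside the
    limit was rejected when its code was reached. *)
Lemma limit_world : consistent Ax S -> world Ax limit.
Proof.
move=> cS; split=> [s [cL cR]|x nx].
  have [m hm] := limit_stage cL; have [n hn] := limit_stage cR.
  apply: (stage_consistent (n := maxn m n) cS); split=> A.
    by move=> /hm; apply: stage_leq; apply: leq_maxl.
  by move=> /hn; apply: stage_leq; apply: leq_maxr.
have : ~ consistent Ax (fun z => stage (choice.pickle x) z \/ z = x).
  by move=> cx; apply: nx; exists (choice.pickle x).+1; right; rewrite choice.pickleK.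
move=> /existsNP [s /not_implyP [/covers_add [s' cs' ds]] /contrapT /ds d].
by exists s' => //; apply: covers_sub cs' => y sy; exists (choice.pickle x).
Qed.

End Lindenbaum.

Lemma world_exists Ax L R : ~ der Ax (seq_mset L ⇒ seq_mset R) ->
  exists2 w, world Ax w & (forall A, A \in L -> w (true, A)) /\
                          (forall A, A \in R -> w (false, A)).
Proof.
move=> nd; pose S : signed_set := fun x => x.2 \in if x.1 then L else R.
exists (limit Ax S); last by split=> A hA; exists 0.
apply: limit_world => -[Γ Δ] [cL cR] d; apply: nd; apply: der_sub d => A hA.
  by rewrite mem_seq_mset; apply: cL.
by rewrite mem_seq_mset; apply: cR.
Qed.

(** * Closure of worlds under the propositional rules *)

Definition seqD (s t : sequent) : sequent := s.1 `+` t.1 ⇒ s.2 `+` t.2.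

Lemma prop_stepD ps c t :
  prop_step ps c -> prop_step [seq seqD p t | p <- ps] (seqD c t).
Proof.
case=> *; rewrite /seqD /= -!msetDA.
- exact: Init.
- exact: BotL.
- exact: TopR.
- exact: NegL.
- exact: NegR.
- exact: AndL.
- exact: AndR.
- exact: OrL.
- exact: OrR.
- exact: ImpL.
- exact: ImpR.
Qed.

Lemma coversD (S : signed_set) s t :
  covers S s -> covers S t -> covers S (seqD s t).
Proof.
by move=> [sL sR] [tL tR]; split=> A /=; rewrite in_msetD => /orP[]; auto.
Qed.

Lemma der_seqDl Ax s t u : der Ax (seqD s t) -> der Ax (seqD s (seqD u t)).
Proof.
apply: der_sub => A; rewrite !in_msetD => /orP[] -> //; rewrite ?orbT //.
Qed.

Lemma world_not_covers Ax w s : world Ax w -> ~ covers w s ->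
  exists2 t, covers w t & der Ax (seqD s t).
Proof.
move=> [_ max] ns.
have [A As /max [t ct dt]] : exists2 x : bool * form,
    x.2 \in (if x.1 then s.1 else s.2) & ~ w x.
  apply: contrapT => no; apply: ns; split=> A As; apply: contrapT => nA.
    by apply: no; exists (true, A).
  by apply: no; exists (false, A).
exists t => //; case: A As dt => -[] A /= As; apply: der_sub => B;
  rewrite !(in_msetD, in_mset1D) ?in_mset1 => h; rewrite ?h ?orbT //.
  by case/orP: h => [/eqP->|->]; rewrite ?As ?orbT.
by case/orP: h => [/eqP->|->]; rewrite ?As ?orbT.
Qed.

(** Otherwise each premiss becomes derivable when some context covered by [w] is added; the rule,
    applied with the sum of these contexts, derives a sequent covered by [w]. For a rule without
    premisses this says that [w] never covers its conclusion. *)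
Lemma world_step Ax w ps c : world Ax w -> prop_step ps c -> covers w c ->
  exists2 p, List.In p ps & covers w p.
Proof.
move=> ww st cc; apply: contrapT => no.
have {no} [t ct dt] : exists2 t, covers w t &
    forall p, List.In p ps -> der Ax (seqD p t).
  elim: ps no {st} => [|p ps IH] no.
    by exists (mset0 ⇒ mset0) => //; split=> A; rewrite in_mset0.
  have [|t ct dt] := IH; first by case=> q qp cq; apply: no; exists q => //; right.
  have [|u cu du] := world_not_covers ww (s := p).
    by move=> cp; apply: no; exists p => //; left.
  exists (seqD u t); first exact: coversD.
  move=> q [<-|/dt]; last exact: der_seqDl.
  by apply: der_sub du => A; rewrite !in_msetD => /orP[] ->; rewrite ?orbT.
have [cons _] := ww; apply: cons (coversD cc ct) _.
apply: der_prop (prop_stepD t st) _ => p.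
by move=> /List.in_map_iff [q [<- /dt]].
Qed.

(** * Neighbourhoods, forcing and the truth lemma *)

Definition unboxes_in (l : seq (bool * form)) (w : signed_set) : Prop :=
  forall x, x \in l -> w (true, unbox x).

Definition boxes_in (l : seq (bool * form)) (w : signed_set) : Prop :=
  forall x, x \in l -> w (true, Box x.2).

(** The basic neighbourhoods consist of the worlds with all of [unboxes l] on the left, and are
    closed upwards. N decides whether [l] may be empty, C whether it may be long. *)
Definition neighbourhood Ax (w : signed_set) (X : signed_set -> Prop) : Prop :=
  exists l, [/\ unboxable Ax l, boxes_in l w &
    forall v, world Ax v -> unboxes_in l v -> X v].

Fixpoint forces Ax (A : form) (w : signed_set) : bool :=
  match A with
  | Var p => `[< w (true, Var p) >]
  | Bot => false
  | Top => true
  | Neg A => ~~ forces Ax A w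
  | And A B => forces Ax A w && forces Ax B w
  | Or A B => forces Ax A w || forces Ax B w
  | Imp A B => forces Ax A w ==> forces Ax B w
  | Box A => `[< neighbourhood Ax w (fun v => forces Ax A v) >]
  end.

(** Forcing is a Boolean assignment with boxed formulas as atoms, so tautologies are forced. *)
Lemma forces_truth Ax A w : forces Ax A w =
  truth (fun p => forces Ax (Var p) w) (fun B => forces Ax (Box B) w) A.
Proof. by elim: A => //= [A ->|A -> B ->|A -> B ->|A -> B ->]. Qed.

Lemma world_unboxes Ax l B : ~ der Ax (seq_mset (unboxes l) ⇒ seq_mset B) ->
  exists2 v, world Ax v & unboxes_in l v /\ (forall A, A \in B -> v (false, A)).
Proof.
move=> /world_exists [v wv [vL vR]]; exists v => //; split=> // x xl.
by apply/vL/map_f.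
Qed.

Lemma covers_boxes l (w : signed_set) (Δ : {mset form}) : boxes_in l w ->
  (forall A, A \in Δ -> w (false, A)) -> covers w (seq_mset (boxes l) ⇒ Δ).
Proof.
by move=> lw wD; split=> // A; rewrite mem_seq_mset => /mapP [x /lw ? ->].
Qed.

Lemma covers_left (w : signed_set) A :
  w (true, A) -> covers w (A +` mset0 ⇒ mset0).
Proof.
move=> wA; split=> B /=; last by rewrite in_mset0.
by rewrite in_mset1D in_mset0 orbF => /eqP ->.
Qed.

Lemma covers_right (w : signed_set) A :
  w (false, A) -> covers w (mset0 ⇒ A +` mset0).
Proof.
move=> wA; split=> B /=; first by rewrite in_mset0.
by rewrite in_mset1D in_mset0 orbF => /eqP ->.
Qed.

Lemma coversLE (w : signed_set) A Γ Δ :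
  covers w (A +` Γ ⇒ Δ) -> w (true, A) /\ covers w (Γ ⇒ Δ).
Proof.
move=> [cL cR]; split; first by apply: cL; apply: mset1D1.
by split=> // B BG; apply: cL; apply: mset1Dr.
Qed.

Lemma coversRE (w : signed_set) A Γ Δ :
  covers w (Γ ⇒ A +` Δ) -> w (false, A) /\ covers w (Γ ⇒ Δ).
Proof.
move=> [cL cR]; split; first by apply: cR; apply: mset1D1.
by split=> // B BD; apply: cR; apply: mset1Dr.
Qed.

(** Two implications rather than an equivalence: without cut, a formula is not known to lie on
    either side of a world. *)
Lemma truth_lemma Ax A w : world Ax w ->
  (w (true, A) -> forces Ax A w) /\ (w (false, A) -> ~~ forces Ax A w).
Proof.
elim: A w => [p|||A IHA|A IHA B IHB|A IHA B IHB|A IHA B IHB|A IHA] w ww;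
  have L ps c st cc := @world_step Ax w ps c ww st cc;
  try have [At Af] := IHA w ww; try have [Bt Bf] := IHB w ww; split=> wA /=;
  try (have cA := covers_left wA); try (have cA := covers_right wA).
- exact/asboolP.
- apply/asboolP => wp; have [] // := L _ _ (Init p mset0 mset0) _.
  by split=> B; rewrite in_mset1D in_mset0 orbF => /eqP ->.
- by have [] := L _ _ (BotL _ _) cA.
- by [].
- by [].
- by have [] := L _ _ (TopR _ _) cA.
- have [p [<-|[]] /coversRE [/Af]] // := L _ _ (NegL _ _ _) cA.
- have [p [<-|[]] /coversLE [/At ->]] // := L _ _ (NegR _ _ _) cA.
- have [p [<-|[]] /coversLE [/At -> /coversLE [/Bt ->]]] // :=
    L _ _ (AndL _ _ _ _) cA.
- have [p [<-|[<-|[]]] /coversRE []] := L _ _ (AndR _ _ _ _) cA.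
    by move=> /Af /negPf ->.
  by move=> /Bf /negPf ->; rewrite andbF.
- have [p [<-|[<-|[]]] /coversLE []] := L _ _ (OrL _ _ _ _) cA.
    by move=> /At ->.
  by move=> /Bt ->; rewrite orbT.
- have [p [<-|[]] /coversRE [/Af/negPf -> /coversRE [/Bf/negPf ->]]] // :=
    L _ _ (OrR _ _ _ _) cA.
- have [p [<-|[<-|[]]]] := L _ _ (ImpL _ _ _ _) cA.
    by move=> /coversRE [/Af /negPf ->].
  by move=> /coversLE [/Bt ->]; rewrite implybT.
- have [p [<-|[]] /coversLE [/At -> /coversRE [/Bf /negPf ->]]] // :=
    L _ _ (ImpR _ _ _ _) cA.
(* A single formula with its box dropped is always unboxable. *)
- apply/asboolP; exists [:: (false, A)]; split=> //.
  + by split=> // x; rewrite inE => /eqP ->.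
  + by move=> x; rewrite inE => /eqP ->.
  by move=> v wv lv; apply: (IHA v wv).1; apply: (lv (false, A)); apply: mem_head.
apply/asboolP => -[l [lok lw lX]].
(* Either [der_box] contradicts the consistency of [w], or some world of the basic neighbourhood has
   [A] on the right. *)
have [/(der_box lok) d|nd] := pselect (der Ax (seq_mset (unboxes l) ⇒ [mset A])).
  have [cons _] := ww; apply: cons _ d; apply: covers_boxes => // B.
  by rewrite in_mset1 => /eqP ->.
have [|v wv [lv /(_ A) vA]] := @world_unboxes Ax l [:: A].
  by rewrite mset_cons seq_mset_nil msetD0.
have [_ /(_ (vA (mem_head _ _))) /negP] := IHA v wv.
by apply; apply: lX.
Qed.

(** * Frame conditions for the modal axioms *)

Lemma neighbourhoodI (Ax : {set modal_axiom}) w X Y : AxC \in Ax ->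
  neighbourhood Ax w X -> neighbourhood Ax w Y ->
  neighbourhood Ax w (fun v => X v /\ Y v).
Proof.
move=> inC [l [[l4 lN lC] lw lX]] [m [[m4 mN mC] mw mY]].
exists (l ++ m); split.
- split=> // [x|lm]; first by rewrite mem_cat => /orP[/l4|/m4].
  by apply: lN; case: (l) lm.
- by move=> x; rewrite mem_cat => /orP[/lw|/mw].
move=> v wv lmv; split; [apply: lX|apply: mY] => // x xl;
  by apply: lmv; rewrite mem_cat xl ?orbT.
Qed.

(** Were the basic neighbourhood empty, the unboxed formulas would be inconsistent, and P would pass
    this on to their boxes in [w]. *)
Lemma neighbourhood_nonempty (Ax : {set modal_axiom}) w X : AxP \in Ax ->
  world Ax w -> neighbourhood Ax w X -> exists v, X v.
Proof.
move=> inP [cons _] [l [lok lw lX]].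
have [|v wv [lv _]] := @world_unboxes Ax l [::].
  rewrite seq_mset_nil => /(der_P inP lok).
  by apply: cons; apply: covers_boxes => // A; rewrite in_mset0.
by exists v; apply: lX.
Qed.

Lemma world_T (Ax : {set modal_axiom}) w A : AxT \in Ax -> world Ax w ->
  w (true, Box A) -> w (true, A).
Proof.
move=> inT [cons max] wbA; apply: contrapT => /max [[Γ Δ] cs ds].
apply: (cons (Box A +` Γ ⇒ Δ)); last exact: der_T.
case: cs => cL cR; split=> //= B; rewrite in_mset1D => /orP[/eqP->//|].
exact: cL.
Qed.

(** [w] lies in each of its basic neighbourhoods: kept boxes are in [w] already, and T supplies the
    formulas whose box is dropped. *)
Lemma neighbourhood_self (Ax : {set modal_axiom}) w X : AxT \in Ax ->
  world Ax w -> neighbourhood Ax w X -> X w.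
Proof.
move=> inT ww [l [_ lw lX]]; apply: lX => // -[c A] /lw wbA.
by case: c wbA => //= wbA; apply: (world_T inT ww wbA).
Qed.

(** Keeping every box makes the list [l] itself available again in each world of the new
    neighbourhood. *)
Lemma neighbourhood_4 (Ax : {set modal_axiom}) w X : Ax4 \in Ax ->
  neighbourhood Ax w X -> neighbourhood Ax w (fun v => neighbourhood Ax v X).
Proof.
move=> in4 [l [[l4 lN lC] lw lX]].
exists [seq (true, x.2) | x <- l]; split.
- split=> // [/eqP|]; last by rewrite size_map.
  by rewrite -size_eq0 size_map size_eq0 => /eqP.
- by move=> _ /mapP [x xl ->]; exact: (lw x xl).
move=> v wv lv; exists l; split=> // x xl.
exact/(lv (true, x.2))/map_f.
Qed.

(* Rule D consumes one formula of the two lists; the remaining formulas have to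
   fit the rule premiss again, which without C leaves at most one of them. *)
Lemma unboxes_D (Ax : {set modal_axiom}) l m w A : AxD \in Ax -> world Ax w ->
  unboxable Ax l -> unboxable Ax m -> boxes_in l w -> boxes_in m w ->
  (false, A) \in l -> ~ der Ax (seq_mset (unboxes (l ++ m)) ⇒ mset0).
Proof.
move=> inD [cons _] [l4 lN lC] [m4 mN mC] lw mw Al d.
have [k [kok kw ksub]] : exists k, [/\ unboxable Ax k, boxes_in k w &
    {subset l ++ m <= (false, A) :: k}].
  have [inC|nC] := boolP (AxC \in Ax).
    (* Keeping [A] in the list as well is harmless, since sequents matter only up to
       multiplicity. *)
    exists (l ++ m); split.
    - split=> // [x|lm]; first by rewrite mem_cat => /orP[/l4|/m4].
      by move: Al; case: (l) lm.
    - by move=> x; rewrite mem_cat => /orP[/lw|/mw].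
    by move=> x xl; rewrite inE xl orbT.
  exists m; split=> // x; rewrite mem_cat inE => /orP[xl|->]; last by rewrite orbT.
  have : size l <= 1 by rewrite leqNgt; apply/negP => /lC; apply/negP.
  by case: (l) Al xl => [|y [|//]] //; rewrite !inE => /eqP <- ->.
apply: (cons (Box A +` seq_mset (boxes k) ⇒ mset0)).
  split=> B; rewrite ?in_mset0 // in_mset1D mem_seq_mset.
  by case/orP=> [/eqP->|/mapP [x /kw ? ->//]]; apply: lw Al.
apply: der_D => //; apply: der_sub d => // B; rewrite mem_seq_mset.
move=> /mapP [x /ksub + ->]; rewrite in_mset1D mem_seq_mset inE.
by case/orP=> [/eqP->|xk]; rewrite ?eqxx // (map_f unbox xk) orbT.
Qed.

(** If some box of the two lists is dropped, rule D applies to that formula; if all are kept, [w]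
    itself lies in both neighbourhoods. *)
Lemma neighbourhood_meet (Ax : {set modal_axiom}) w X Y : AxD \in Ax ->
  world Ax w -> neighbourhood Ax w X -> neighbourhood Ax w Y ->
  exists2 v, X v & Y v.
Proof.
move=> inD ww [l [lok lw lX]] [m [mok mw mY]].
suff [v wv lmv] : exists2 v, world Ax v & unboxes_in (l ++ m) v.
  by exists v; [apply: lX|apply: mY] => // x xl;
    apply: lmv; rewrite mem_cat xl ?orbT.
have [[x]|kept] := pselect (exists2 x, x \in l ++ m & ~~ x.1); last first.
  exists w => // x xlm; have : x.1 by apply: contrapT => /negP x1; apply: kept; exists x.
  rewrite /unbox => ->; move: xlm; rewrite mem_cat => /orP[]; [exact: lw|exact: mw].
case: x => -[] // A Alm _.
have nd : ~ der Ax (seq_mset (unboxes (l ++ m)) ⇒ seq_mset [::]).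
  rewrite seq_mset_nil => d; move: Alm; rewrite mem_cat => /orP[Al|Am].
    exact: unboxes_D lok mok lw mw Al d.
  apply: unboxes_D mok lok mw lw Am _ => //; apply: der_sub d => // B.
  by rewrite !mem_seq_mset /unboxes !map_cat !mem_cat orbC.
by have [v wv [lmv _]] := world_unboxes nd; exists v.
Qed.

Lemma neighbourhood_sub Ax w (X Y : signed_set -> Prop) :
  (forall v, world Ax v -> X v -> Y v) ->
  neighbourhood Ax w X -> neighbourhood Ax w Y.
Proof.
by move=> sub [l [lok lw lX]]; exists l; split=> // v wv /(lX v wv)/(sub v wv).
Qed.

Lemma axiom_forces (Ax : {set modal_axiom}) a A w : a \in Ax -> axiom_instance a A ->
  world Ax w -> forces Ax A w.
Proof.
move=> + st; case: {a} A / st => [A B inC|inN|inP|A inD|A inT|A in4] ww /=.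
- apply/implyP => /andP[/asboolP nA /asboolP nB]; apply/asboolP.
  by apply: neighbourhood_sub (neighbourhoodI inC nA nB) => v _ [-> ->].
- by apply/asboolP; exists [::]; split.
- by apply/asboolP => /(neighbourhood_nonempty inP ww) [].
- apply/negP => /andP[/asboolP nA /asboolP nB].
  by have [v /= ->] := neighbourhood_meet inD ww nA nB.
- by apply/implyP => /asboolP /(neighbourhood_self inT ww).
apply/implyP => /asboolP nA; apply/asboolP.
by apply: neighbourhood_sub (neighbourhood_4 in4 nA) => v _ ?; apply/asboolP.
Qed.

(** Upward closure of the neighbourhoods accounts for both M and the congruence rule. *)
Lemma logicM_forces Ax A : logicM Ax A -> forall w, world Ax w -> forces Ax A w.
Proof.
elim=> {A} [A tA|A B|a A aAx st|A B _ fA _ fAB|A B _ fAB _ _] w ww.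
- by rewrite forces_truth; apply: tA.
- apply/implyP => /= /asboolP nAB.
  by apply/andP; split; apply/asboolP;
    apply: neighbourhood_sub nAB => v _ /andP[].
- exact: axiom_forces st ww.
- by have /implyP := fAB w ww; apply; apply: fA.
apply/implyP => /asboolP nA; apply/asboolP; apply: neighbourhood_sub nA => v wv.
by apply/implyP/fAB.
Qed.

Lemma completeness Ax A :
  logicM Ax A -> derivable (LNS_M_ConW Ax) (Comp (mset0 ⇒ [mset A])).
Proof.
move=> pA; apply: contrapT => nd.
have [|w ww [_ /(_ A (mem_head _ _)) wA]] := @world_exists Ax [::] [:: A].
  (* The empty prefix turns [der] into plain derivability. *)
  by rewrite mset_cons !seq_mset_nil msetD0 => /(_ [::]).
by have [_ /(_ wA) /negP] := truth_lemma A ww; apply; apply: logicM_forces.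
Qed.

Theorem mainTheorem12 (Ax : {set modal_axiom}) (A : form) :
  logicM Ax A <-> derivable (LNS_M_ConW Ax) (Comp (mset0 ⇒ [mset A])).
Proof. by split; [apply: completeness | apply: soundness]. Qed.
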